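(* Let $G$ be a clique tree of order $n$ in $\mathcal{CT}^{\geqslant 2}_{odd}$. Then $\mathrm{rk}(\mathcal E(G))=4$. Moreover, $\mathcal E(G)$ has exactly two positive and two negative eigenvalues (counted with multiplicity), that is, $\mathrm{In}(\mathcal E(G))=(2,2,n-4)$.
   Context: Graphs are finite, simple and undirected. A cut-vertex of a connected graph $G$ is a vertex whose removal disconnects $G$; a block of $G$ is a maximal connected subgraph $B$ having no cut-vertices of its own (no cut-vertex of $B$). A clique tree is a connected graph whose blocks are all complete graphs. $\mathcal{CT}$ is the class of clique trees $G$ such that each block of $G$ contains at most two cut-vertices of $G$. $\mathcal{CT}^{\geqslant 2}$ is the set of graphs in $\mathcal{CT}$ with diameter at least $2$, and $\mathcal{CT}^{\geqslant 2}_{odd}$ is the set of graphs in $\mathcal{CT}^{\geqslant 2}$ with odd diameter. For a connected graph $G$, $d_G(u,v)$ is the distance and $e_G(u)=\max\{d_G(u,v)\mid v\in V_G\}$ the eccentricity of $u$. The eccentricity matrix $\mathcal E(G)=(\epsilon_{uv})$, indexed by $V_G\times V_G$, has $\epsilon_{uv}=d_G(u,v)$ if $d_G(u,v)=\min\{e_G(u),e_G(v)\}$ and $\epsilon_{uv}=0$ otherwise. The inertia of a real symmetric matrix $M$ is $\mathrm{In}(M)=(n_+(M),n_-(M),n_0(M))$, the numbers of positive, negative and zero eigenvalues of $M$ counted with multiplicity. *)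

(* Defs.v *)
From HB Require Import structures.
From mathcomp Require Import all_boot all_order all_algebra.
From mathcomp Require Import reals.
From mathcomp Require Import polyrcf.

Set Implicit Arguments.
Unset Strict Implicit.
Unset Printing Implicit Defensive.

Import Order.TTheory GRing.Theory Num.Theory.

Record sgraph := SGraph {
  vertex :> finType;
  adj : rel vertex;
  adj_sym : symmetric adj;
  adj_irrefl : irreflexive adj
}.
Arguments adj {G} : rename.

(* Subgraphs are not assumed induced: the edge relation of a subgraph may be
   any symmetric part of the adjacency of G between the chosen vertices. *)
Record subgraph (G : sgraph) := Subgraph {
  sverts : {set G};
  sadj : rel G;
  sadj_sym : symmetric sadj;
  sadjP : forall u v, sadj u v -> [&& u \in sverts, v \in sverts & adj u v]
}.

Definition sub_subgraph (G : sgraph) (A B : subgraph G) : Prop :=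
  sverts A \subset sverts B /\ subrel (sadj A) (sadj B).

(* In the next two definitions the pair (W, f) stands for the graph on the
   vertex set W whose edges are the f-edges with both ends in W. With this
   definition the graph on the empty set is connected, so that the vertex of
   the one-vertex graph is not a cut-vertex. *)
Definition connected_on (T : finType) (W : {set T}) (f : rel T) : bool :=
  [forall u in W, forall v in W,
     connect [rel x y | [&& x \in W, y \in W & f x y]] u v].

Definition cut_vertices (T : finType) (W : {set T}) (f : rel T) : {set T} :=
  [set x in W | ~~ connected_on (W :\ x) f].

Definition connected_graph (G : sgraph) : bool :=
  connected_on [set: G] (@adj G).

Definition connected_without_cut_vertex (G : sgraph) (B : subgraph G) : bool :=
  connected_on (sverts B) (sadj B) && (cut_vertices (sverts B) (sadj B) == set0).

Definition is_block (G : sgraph) (B : subgraph G) : Prop :=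
  connected_without_cut_vertex B /\
  forall B' : subgraph G,
    connected_without_cut_vertex B' -> sub_subgraph B B' -> sub_subgraph B' B.

Definition complete_subgraph (G : sgraph) (B : subgraph G) : Prop :=
  {in sverts B &, forall u v, u != v -> sadj B u v}.

Definition clique_tree (G : sgraph) : Prop :=
  connected_graph G /\
  forall B : subgraph G, is_block B -> complete_subgraph B.

Definition CT (G : sgraph) : Prop :=
  clique_tree G /\
  forall B : subgraph G, is_block B ->
    #|sverts B :&: cut_vertices [set: G] (@adj G)| <= 2.

(* v is reached from u by a walk with exactly k edges. *)
Definition has_walk (G : sgraph) (u v : G) (k : nat) : bool :=
  [exists p : k.-tuple G, path adj u p && (last u p == v)].

(* The least length of a walk from u to v. In a connected graph it is smaller
   than #|G|; the value is #|G| when v is not reachable from u. *)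
Definition dist (G : sgraph) (u v : G) : nat :=
  find (has_walk u v) (iota 0 #|G|).

Definition ecc (G : sgraph) (u : G) : nat := \max_(v : G) dist u v.

Definition diam (G : sgraph) : nat := \max_(u : G) ecc u.

Definition CT_ge2 (G : sgraph) : Prop := CT G /\ 2 <= diam G.

Definition CT_ge2_odd (G : sgraph) : Prop := CT_ge2 G /\ odd (diam G).

Local Open Scope ring_scope.

Definition ecc_entry (R : realType) (G : sgraph) (u v : G) : R :=
  if dist u v == minn (ecc u) (ecc v) then (dist u v)%:R else 0.

(* Rows and columns are indexed by the vertices via enum_val. *)
Definition ecc_mx (R : realType) (G : sgraph) : 'M[R]_#|G| :=
  \matrix_(i, j) ecc_entry R (enum_val i) (enum_val j).

(* Number of eigenvalues of M satisfying P, counted with algebraic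
   multiplicity; rootsR enumerates the real roots without repetition. *)
Definition eigen_count (R : realType) (n : nat) (M : 'M[R]_n) (P : pred R)
    : nat :=
  (\sum_(x <- rootsR (char_poly M) | P x) mup x (char_poly M))%N.

(* (n_+(M), n_-(M), n_0(M)) for a symmetric real matrix M. *)
Definition inertia (R : realType) (n : nat) (M : 'M[R]_n) : nat * nat * nat :=
  (eigen_count M (fun x => 0 < x),
   eigen_count M (fun x => x < 0),
   eigen_count M (fun x => x == 0)).

(* Main.v *)
Require Import Defs.
From mathcomp Require Import all_boot all_order all_algebra.
From mathcomp Require Import reals.
From mathcomp Require Import polyrcf spectral complex zify ring.

(* The middle edge c1 c2 of a diametral path, of length 2k+1, lies in a block S,
   which is a clique. A path leaving S and returning to it elsewhere could be
   added to the block, so every vertex u hangs from exactly one vertex p(u) of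
   S, and d(u,v) = a(u) + a(v) + 1 as soon as p(u) <> p(v), where
   a(u) = d(u,p(u)). A vertex of S other than c1 and c2 from which something
   hangs would be a third cut-vertex of S. Hence a <= k, the value k is reached
   only below c1 and c2, and e(u) = a(u) + k + 1; therefore the entry (u,v) is
   nonzero iff p(u) <> p(v) and a(u) = k or a(v) = k. With f_i the indicator
   of the vertices at depth k below c_i, this gives
   E = f_1 g_2^T + g_2 f_1^T + f_2 g_1^T + g_1 f_2^T for suitable columns g_i,
   whence rk E <= 4. If l1, l2 are the ends of the path, the quadratic form of E
   is positive definite on the span of e_(l1) + e_(c2) and e_(l2) + e_(c1), and
   negative definite on the span of e_(l1) - e_(c2) and e_(l2) - e_(c1); by the
   spectral theorem there are at least two eigenvalues of each sign. *)

Set Implicit Arguments.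
Unset Strict Implicit.
Unset Printing Implicit Defensive.

Import Order.TTheory GRing.Theory Num.Theory.

(** * Distances *)

Lemma has_walkP (G : sgraph) (u v : G) k :
  reflect (exists p, [/\ path adj u p, last u p = v & size p = k])
          (has_walk u v k).
Proof.
apply: (iffP existsP) => [[p /andP[up /eqP lp]]|[p [up lp sp]]].
  by exists p; rewrite size_tuple.
by exists (Tuple (introT eqP sp)); rewrite up lp eqxx.
Qed.

Lemma dist_le_size (G : sgraph) (u : G) p :
  path adj u p -> dist u (last u p) <= size p.
Proof.
move=> up; rewrite leqNgt; apply/negP => lt_p.
have := before_find 0 lt_p; rewrite nth_iota ?add0n.
  by move/has_walkP; apply; exists p.
apply: leq_trans lt_p _; rewrite -[X in _ <= X](size_iota 0).
exact: find_size.
Qed.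

Lemma connected_graphP (G : sgraph) :
  reflect (forall u v : G, connect adj u v) (connected_graph G).
Proof.
have eqc : connect [rel x y : G | [&& x \in [set: G], y \in [set: G] & adj x y]]
    =2 connect adj by apply: eq_connect => x y; rewrite /= !inE.
apply: (iffP forall_inP) => conG u; last first.
  by move=> _; apply/forall_inP => v _; rewrite eqc.
by move=> v; rewrite -eqc; apply: (forall_inP (conG u (in_setT u))).
Qed.

(** A path without repeated vertices is shorter than [#|G|], so the search performed by [dist]
    succeeds. *)
Lemma geodesic (G : sgraph) (u v : G) : connect adj u v ->
  exists p, [/\ path adj u p, last u p = v & size p = dist u v].
Proof.
case/connectP => p0 up0 lp0.
case/shortenP: up0 lp0 => p up /card_uniqP cp _ /esym lp.
have ltp : size p < #|G| by rewrite (leq_trans _ (max_card (mem (u :: p)))) ?cp.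
have hw : has (has_walk u v) (iota 0 #|G|).
  apply/hasP; exists (size p); first by rewrite mem_iota.
  by apply/has_walkP; exists p.
apply/has_walkP; have := nth_find 0 hw; rewrite nth_iota //.
by rewrite has_find size_iota in hw.
Qed.

Lemma distxx (G : sgraph) (u : G) : dist u u = 0.
Proof. by apply/eqP; rewrite -leqn0 (@dist_le_size _ u [::]). Qed.

Lemma dist_adj (G : sgraph) (u v : G) : adj u v -> dist u v <= 1.
Proof. by move=> uv; apply: (@dist_le_size _ u [:: v]); rewrite /= uv. Qed.

Lemma dist_sym (G : sgraph) (u v : G) :
  connected_graph G -> dist u v = dist v u.
Proof.
move=> /connected_graphP conG; suff le_d (x y : G) : dist x y <= dist y x.
  by apply/eqP; rewrite eqn_leq !le_d.
have [p [yp <- <-]] := geodesic (conG y x).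
have := @dist_le_size _ (last y p) (rev (belast y p)).
rewrite size_rev size_belast rev_path (eq_path (e' := adj)) => [/(_ yp)|a b].
  by case: p {yp} => [|z p] //=; rewrite rev_cons last_rcons.
by rewrite /= adj_sym.
Qed.

Lemma dist_triangle (G : sgraph) (u v w : G) : connected_graph G ->
  dist u w <= dist u v + dist v w.
Proof.
move=> /connected_graphP conG.
have [p [up <- <-]] := geodesic (conG u v).
have [q [pq <- <-]] := geodesic (conG (last u p) w).
by rewrite -size_cat -last_cat dist_le_size // cat_path up.
Qed.

Lemma dist_eq0 (G : sgraph) (u v : G) : connected_graph G ->
  (dist u v == 0) = (u == v).
Proof.
move=> /connected_graphP conG; apply/eqP/eqP => [d0|->]; last exact: distxx.
by have [p [_ lp]] := geodesic (conG u v); rewrite d0 -lp => /size0nil ->.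
Qed.

(** The path must use an edge leaving [A], and such an edge starts at [x]; hence [belast], the
    sources of edges. *)
Lemma path_exit (T : eqType) (e : rel T) (A : pred T) (x u : T) p :
    (forall a b, e a b -> A a -> ~~ A b -> a = x) ->
  path e u p -> A u -> ~~ A (last u p) -> x \in belast u p.
Proof.
move=> exitx; elim: p u => [|v p IHp] u /= => [_ -> //|/andP[uv vp] Au Alast].
have [Av|Av] := boolP (A v); first by rewrite inE (IHp v) ?orbT.
by rewrite inE (exitx _ _ uv Au Av) eqxx.
Qed.

(** Every geodesic from [u] to [v] passes the gate [x]; cutting it there gives the bound opposite to
    the triangle inequality. *)
Lemma dist_exit (G : sgraph) (A : pred G) (x u v : G) : connected_graph G ->
    (forall a b, adj a b -> A a -> ~~ A b -> a = x) -> A u -> ~~ A v ->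
  dist u v = dist u x + dist x v.
Proof.
move=> conG exitx Au Av; apply/eqP; rewrite eqn_leq dist_triangle //=.
have /connected_graphP/(_ u v)/geodesic[p [up lp <-]] := conG.
have := path_exit exitx up Au; rewrite lp => /(_ Av)/mem_belast xp.
case/splitPl: xp up lp => p1 p2 lx.
rewrite cat_path last_cat size_cat lx => /andP[up1 xp2] <-.
by rewrite leq_add ?dist_le_size // -lx dist_le_size.
Qed.

(** * Blocks and the branches hanging from them *)

Definition restrict (T : finType) (W : {set T}) (f : rel T) : rel T :=
  fun x y => [&& x \in W, y \in W & f x y].
Arguments restrict {T} W f x y /.

Lemma connect_restrict_sym (T : finType) (W : {set T}) (f : rel T) :
  symmetric f -> connect_sym (restrict W f).
Proof.
move=> f_sym; apply: sym_connect_sym => x y.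
by rewrite /= f_sym andbCA.
Qed.

Lemma connect_restrict_path (T : finType) (W : {set T}) (f : rel T) u p :
  path f u p -> {subset u :: p <= W} -> connect (restrict W f) u (last u p).
Proof.
elim: p u => [|v p IHp] u //= /andP[uv vp] sW.
apply: (@connect_trans _ _ v); first apply: connect1.
  by rewrite /= uv !sW ?inE ?eqxx ?orbT.
by apply: IHp => // w wp; rewrite sW // inE wp orbT.
Qed.

Lemma connected_on_sub (T : finType) (W : {set T}) (f g : rel T) :
  {in W &, forall x y, f x y -> g x y} -> connected_on W f -> connected_on W g.
Proof.
move=> sfg /forall_inP conW; apply/forall_inP => u uW; apply/forall_inP => v vW.
have := forall_inP (conW u uW) v vW; apply: connect_sub => x y /and3P[xW yW xy].
by apply: connect1; rewrite /= xW yW sfg.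
Qed.

Lemma cut_vertices0P (T : finType) (W : {set T}) (f : rel T) :
  reflect {in W, forall x, connected_on (W :\ x) f} (cut_vertices W f == set0).
Proof.
apply: (iffP eqP) => [cut0 x xW|conW].
  by have := in_set0 x; rewrite -cut0 inE xW => /negbFE.
by apply/setP => x; rewrite !inE; case: (boolP (x \in W)) => //= /conW ->.
Qed.

Lemma induced_adjP (G : sgraph) (S : {set G}) u v :
  restrict S adj u v -> [&& u \in S, v \in S & adj u v].
Proof. by []. Qed.

Lemma induced_adj_sym (G : sgraph) (S : {set G}) :
  symmetric (restrict S (@adj G)).
Proof. by move=> u v; rewrite /= adj_sym andbCA. Qed.

Definition induced (G : sgraph) (S : {set G}) : subgraph G :=
  Subgraph (@induced_adj_sym G S) (@induced_adjP G S).

(** [Z] has at most one element: the empty set gives connectedness, singletons the absence of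
    cut-vertices. *)
Lemma induced_without_cut_vertex (G : sgraph) (S : {set G}) :
    (forall Z : {set G}, {in Z &, forall a b, a = b} ->
      connected_on (S :\: Z) adj) ->
  connected_without_cut_vertex (induced S).
Proof.
have sub (Z : {set G}) : connected_on (S :\: Z) adj ->
    connected_on (S :\: Z) (restrict S adj).
  apply: connected_on_sub => x y.
  by rewrite !inE => /andP[_ xS] /andP[_ yS] xy; apply/and3P.
move=> conS; apply/andP; split.
  by rewrite -[sverts _]setD0; apply/sub/conS => a b; rewrite inE.
apply/cut_vertices0P => x _; apply/sub/conS => a b.
by rewrite !inE => /eqP -> /eqP ->.
Qed.

Lemma induced_of_subgraph (G : sgraph) (B : subgraph G) :
  connected_without_cut_vertex B ->
  connected_without_cut_vertex (induced (sverts B)).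
Proof.
have sub (x y : G) : sadj B x y -> restrict (sverts B) adj x y by exact: sadjP.
case/andP => conB /cut_vertices0P cutB; apply/andP; split.
  by apply: connected_on_sub conB => x y _ _; apply: sub.
apply/cut_vertices0P => x xB.
by apply: connected_on_sub (cutB x xB) => y z _ _; apply: sub.
Qed.

(** Passing to the induced subgraph only adds edges, so maximality among vertex sets yields
    maximality among all subgraphs. *)
Lemma maxset_block (G : sgraph) (S : {set G}) :
  maxset (fun S => connected_without_cut_vertex (induced S)) S ->
  is_block (induced S).
Proof.
move=> /maxsetP[cwS maxS]; split=> // B cwB [sSB _].
have SB := maxS _ (induced_of_subgraph cwB) sSB.
split=> [|u v /sadjP]; first by rewrite SB.
by rewrite SB.
Qed.

Lemma edge_in_maxset (G : sgraph) (u v : G) : adj u v ->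
  exists S, [/\ maxset (fun S => connected_without_cut_vertex (induced S)) S,
                u \in S & v \in S].
Proof.
move=> uv; have cw : connected_without_cut_vertex (induced [set u; v]).
  apply: induced_without_cut_vertex => Z _.
  apply/forall_inP => x xW; apply/forall_inP => y yW.
  have [->|nxy] := eqVneq x y; first exact: connect0.
  apply: connect1; rewrite /= xW yW; move: xW yW; rewrite !inE.
  case/andP=> _ /orP[]/eqP xE /andP[_ /orP[]/eqP yE]; move: nxy;
    by rewrite xE yE ?eqxx // adj_sym.
have [S maxS /subsetP sS] := @maxset_exists _
  (fun S => connected_without_cut_vertex (induced S)) _ cw.
by exists S; split; rewrite ?sS ?inE ?eqxx ?orbT.
Qed.

(* An ear attached to a block at two distinct vertices would extend it. *)
Lemma no_ear (G : sgraph) (S : {set G}) (x y a b : G) :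
    maxset (fun S => connected_without_cut_vertex (induced S)) S ->
    {in S &, forall u v, u != v -> adj u v} ->
    x \in S -> y \in S -> x != y -> a \notin S -> adj x a -> adj b y ->
  ~~ connect (restrict (~: S) adj) a b.
Proof.
move=> /maxsetP[cwS maxS] cliqueS xS yS nxy aS xa b_y.
apply/negP => /connectP[p0 ap0 lp0].
case/shortenP: ap0 lp0 => p ap uniq_ap _ lp.
have apS : {subset a :: p <= ~: S}.
  elim: p a aS ap {uniq_ap lp xa} => [|c p IHp] a aS /=.
    by move=> _ z; rewrite !inE => /eqP ->.
  case/andP => /and3P[aSC cSC _] cp z; rewrite inE => /predU1P[->//|].
  by apply: (IHp c) => //; rewrite inE in cSC.
have {}ap : path adj a p by apply: sub_path ap => c d /and3P[].
set T := S :|: [set z in a :: p].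
have cwT : connected_without_cut_vertex (induced T).
  apply: induced_without_cut_vertex => Z Z1; set W := T :\: Z.
  have symW := connect_restrict_sym W (@adj_sym G).
  have conS s t : s \in S :\: Z -> t \in S :\: Z ->
      connect (restrict W adj) s t.
    rewrite !inE => /andP[sZ sS] /andP[tZ tS].
    have [->|nst] := eqVneq s t; first exact: connect0.
    by apply: connect1; rewrite /= !inE sZ sS tZ tS cliqueS.
  (* Deleting [Z] removes at most one vertex, so what is left of the ear can still walk to a
     surviving end, [x] or [y]. *)
  have toS w : w \in W ->
      exists2 s, s \in S :\: Z & connect (restrict W adj) w s.
    move=> wW; have /setDP[wT wZ] := wW.
    have /setUP[wS|] := wT; last rewrite in_set => wp.
      by exists w; rewrite ?inE ?wZ ?connect0.
    have pathq : path adj x (rcons (a :: p) y).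
      by rewrite rcons_path /= xa ap /= -lp.
    have uniqq : uniq (x :: rcons (a :: p) y).
      have notin z : z \in S -> z \notin a :: p.
        by move=> zS; apply/negP => /apS; rewrite inE zS.
      by rewrite cons_uniq rcons_uniq mem_rcons inE negb_or nxy !notin.
    have subq : {subset x :: rcons (a :: p) y <= T}.
      move=> z; rewrite inE mem_rcons inE => /or3P[/eqP->|/eqP->|zp].
      - by rewrite inE xS.
      - by rewrite inE yS.
      - by rewrite inE inE zp orbT.
    move: pathq uniqq subq; case/splitPr: wp => p1 p2.
    rewrite rcons_cat rcons_cons => pathq uniqq subq.
    (* If [Z] meets the stretch before [w], the one from [w] to [y] is intact; otherwise the walk
       goes back to [x]. *)
    have [/hasP[z zp1 zZ]|/hasPn xZ] := boolP (has (mem Z) (x :: p1)).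
      exists y.
        rewrite inE yS andbT; apply/negP => yZ.
        move: uniqq; rewrite (Z1 z y) // in zp1.
        rewrite -cat_cons cat_uniq => /and3P[_ /hasPn/(_ y)/= + _].
        by rewrite inE mem_rcons inE eqxx orbT => /(_ isT)/negP.
      move: pathq; rewrite cat_path => /andP[_ /= /andP[_ wp2]].
      have := connect_restrict_path wp2; rewrite last_rcons; apply=> c cp2.
      rewrite inE subq ?andbT; last by rewrite -cat_cons mem_cat cp2 orbT.
      apply/negP => cZ; move: uniqq; rewrite (Z1 z c) // in zp1.
      by rewrite -cat_cons cat_uniq => /and3P[_ /hasPn/(_ c cp2)/negP].
    exists x; first by rewrite inE xS andbT xZ ?mem_head.
    move: pathq; rewrite -cat_rcons cat_path => /andP[xp1 _].
    rewrite symW; have := connect_restrict_path xp1.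
    rewrite last_rcons; apply=> c.
    rewrite inE mem_rcons inE orbCA => /orP[/eqP -> //|cp1].
    apply/setDP; split; last by apply: xZ; rewrite inE.
    by apply: subq; rewrite -cat_cons mem_cat inE cp1.
  apply/forall_inP => u /toS[s sS us]; apply/forall_inP => v /toS[t tS vt].
  by rewrite (connect_trans us) // (connect_trans (conS s t sS tS)) // symW.
have TS : T = S by apply: maxS => //; apply: subsetUl.
by case/negP: aS; rewrite -TS !inE eqxx orbT.
Qed.

Definition branch (G : sgraph) (S : {set G}) (x u : G) : bool :=
  (u == x) || (u \notin S) &&
    [exists a, [&& adj x a, a \notin S & connect (restrict (~: S) adj) a u]].

Lemma branch_refl (G : sgraph) (S : {set G}) x : branch S x x.
Proof. by rewrite /branch eqxx. Qed.

Lemma branch_in (G : sgraph) (S : {set G}) x u :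
  u \in S -> branch S x u = (u == x).
Proof. by rewrite /branch => ->; rewrite orbF. Qed.

Lemma branchP (G : sgraph) (S : {set G}) x u : u != x -> branch S x u ->
  u \notin S /\
  exists a, [/\ adj x a, a \notin S & connect (restrict (~: S) adj) a u].
Proof.
move=> /negPf nux; rewrite /branch nux.
by case/andP=> uS /existsP[a /and3P[xa aS au]]; split=> //; exists a.
Qed.

Lemma branch_step (G : sgraph) (S : {set G}) x u v : v \notin S -> adj u v ->
  branch S x u -> branch S x v.
Proof.
move=> vS uv xu; rewrite /branch vS; apply/orP; right; apply/existsP.
have [ux|nux] := eqVneq u x; first by exists v; rewrite -ux uv vS connect0.
have [uS [a [xa aS au]]] := branchP nux xu.
exists a; rewrite xa aS (connect_trans au) // connect1 //=.
by rewrite !inE uS vS.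
Qed.

(** Along a walk from [x0] the branch is kept outside [S] and replaced by that of [v] when [S] is
    met at [v]. *)
Lemma branch_cover (G : sgraph) (S : {set G}) x0 u : connected_graph G ->
  x0 \in S -> exists2 x, x \in S & branch S x u.
Proof.
move=> /connected_graphP/(_ x0 u)/connectP[p + ->] x0S.
have: exists2 x, x \in S & branch S x x0 by exists x0; rewrite ?branch_refl.
elim: p x0 {x0S} => [|v p IHp] w //= [x xS xw] /andP[wv vp].
apply: IHp vp; have [vS|vS] := boolP (v \in S).
  by exists v; rewrite ?branch_refl.
by exists x; rewrite ?(branch_step vS wv xw).
Qed.

(** An edge leaving the branch elsewhere would enter [S] at a vertex other than [x] and close an
    ear. *)
Lemma branch_exit (G : sgraph) (S : {set G}) x a b :
    maxset (fun S => connected_without_cut_vertex (induced S)) S ->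
    {in S &, forall u v, u != v -> adj u v} -> x \in S ->
  adj a b -> branch S x a -> ~~ branch S x b -> a = x.
Proof.
move=> maxS cliqueS xS ab xa nxb; apply/eqP; apply: contraNT nxb => nax.
have [bS|bS] := boolP (b \in S); last exact: branch_step bS ab xa.
have [aS [c [xc cS ca]]] := branchP nax xa.
rewrite (branch_in _ bS); apply: contraTT ca => nbx.
by apply: (no_ear maxS cliqueS xS bS _ cS xc ab); rewrite eq_sym.
Qed.

(** If [u] is outside [S], joining the two walks at [u] would give an ear from [x] to [y]. *)
Lemma branch_inj (G : sgraph) (S : {set G}) x y u :
    maxset (fun S => connected_without_cut_vertex (induced S)) S ->
    {in S &, forall u v, u != v -> adj u v} -> x \in S -> y \in S ->
  branch S x u -> branch S y u -> x = y.
Proof.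
move=> maxS cliqueS xS yS xu yu; apply/eqP.
have [ux|nux] := eqVneq u x; first by move: yu; rewrite ux (branch_in _ xS).
have [uy|nuy] := eqVneq u y.
  by move: xu; rewrite uy (branch_in _ yS) eq_sym.
have [uS [a [xa aS au]]] := branchP nux xu.
have [_ [b [yb bS bu]]] := branchP nuy yu.
apply: contraTT au => nxy; rewrite adj_sym in yb.
apply: contraNN (no_ear maxS cliqueS xS yS nxy aS xa yb) => au.
by rewrite (connect_trans au) // connect_restrict_sym //; apply: adj_sym.
Qed.

(** [y] is outside the branch, which is left only through [x]; deleting [x] thus separates [u] from
    [y]. *)
Lemma branch_cut (G : sgraph) (S : {set G}) x y u :
    maxset (fun S => connected_without_cut_vertex (induced S)) S ->
    {in S &, forall u v, u != v -> adj u v} -> x \in S -> y \in S -> x != y ->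
  branch S x u -> u != x -> x \in cut_vertices [set: G] (@adj G).
Proof.
move=> maxS cliqueS xS yS nxy xu nux; rewrite !inE /=.
apply/negP => /forall_inP/(_ u); rewrite !inE nux => /(_ isT)/forall_inP/(_ y).
rewrite !inE eq_sym nxy => /(_ isT)/connectP[p up ylast].
have up' : path adj u p by apply: sub_path up => a b /and3P[].
have xyF : ~~ branch S x (last u p) by rewrite -ylast (branch_in _ yS) eq_sym.
have exitx a b := @branch_exit G S x a b maxS cliqueS xS.
have := path_exit exitx up' xu xyF.
elim: p u up {xu nux up' ylast xyF} => [|v p IHp] u //=.
case/andP => /and3P[uX _ _] vp.
by rewrite inE => /predU1P[xu|/(IHp _ vp)//]; move: uX; rewrite !inE xu eqxx.
Qed.

(** * Structure of a clique tree of odd diameter *)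

(** Collects all that the matrix needs. Inside one branch an upper bound on distances is enough, as
    those entries will vanish. *)
Lemma CT_odd_structure (G : sgraph) : CT_ge2_odd G ->
  exists (p : G -> G) (k : nat) (c1 c2 l1 l2 : G),
  [/\ (0 < k)%N /\ c1 != c2,
      [/\ p c1 = c1, p c2 = c2, p l1 = c1 & p l2 = c2],
      dist l1 c1 = k /\ dist l2 c2 = k,
      forall u, dist u (p u) <= k /\ (p u = u \/ p u = c1 \/ p u = c2)
    & forall u v, (p u = p v -> dist u v <= dist u (p u) + dist v (p v)) /\
        (p u != p v -> dist u v = dist u (p u) + dist v (p v) + 1)].
Proof.
case=> [[[[conG completeB] cutB] diam2] odd_diam].
have G_gt0 : 0 < #|G|.
  rewrite lt0n; apply: contraTneq diam2 => G0.
  by rewrite /diam big_pred0 // => u; have := card0_eq G0 u; rewrite inE.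
have [l1 [l2 dl]] : exists l1 l2 : G, dist l1 l2 = diam G.
  have [l1 dl1] := @bigop.eq_bigmax G (@ecc G) G_gt0; rewrite /diam dl1.
  have [l2 dl2] := @bigop.eq_bigmax G (dist l1) G_gt0.
  by exists l1, l2; rewrite -dl2.
have con := conG; move/connected_graphP in con.
set k := (diam G)./2.
have diamE : diam G = k.*2.+1 by rewrite -[LHS]odd_double_half odd_diam.
have k_gt0 : 0 < k.
  by rewrite lt0n; apply: contraTneq diam2 => k0; rewrite diamE k0.
have sym u v := dist_sym u v conG.
have tri u v w := dist_triangle u v w conG.
have dist_diam (u v : G) : dist u v <= k.*2.+1.
  rewrite -diamE; apply: (@leq_trans (ecc u)); first exact: bigop.leq_bigmax.
  exact: (bigop.leq_bigmax u).
have [c1 [c2 [c12 d1 d2]]] :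
    exists c1 c2, [/\ adj c1 c2, dist l1 c1 = k & dist c2 l2 = k].
  have [p [up lp sp]] := geodesic (con l1 l2).
  rewrite dl diamE in sp.
  case Ep : (drop k p) => [|c2 p2].
    by have := congr1 size Ep; rewrite size_drop sp /=; lia.
  have sp1 : size (take k p) = k by rewrite size_takel // sp; lia.
  have sp2 : size p2 = k.
    by have := congr1 size Ep; rewrite size_drop sp /=; lia.
  move: up lp; rewrite -{1 2}(cat_take_drop k p) Ep cat_path last_cat /=.
  set c1 := last l1 _ => /and3P[up1 c12 cp2] lp2.
  exists c1, c2.
  (* The three pieces have lengths at most k, 1, k and add up to at least 2k+1, so the bounds are
     equalities. *)
  have := dist_le_size up1; have := dist_le_size cp2; have := dist_adj c12.
  rewrite lp2 sp1 sp2 -/c1 => ? ? ?.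
  have := tri l1 c1 l2; have := tri c1 c2 l2.
  by rewrite dl diamE; split=> //; lia.
have nc : c1 != c2 by apply: contraTneq c12 => ->; rewrite adj_irrefl.
have [S [maxS c1S c2S]] := edge_in_maxset c12.
have blockS := maxset_block maxS.
have cliqueS : {in S &, forall u v, u != v -> adj u v}.
  by move=> u v uS vS nuv; have /and3P[] := completeB _ blockS u v uS vS nuv.
have cover u : {x | (x \in S) && branch S x u}.
  apply: sigW; have [x xS xu] := branch_cover u conG c1S.
  by exists x; rewrite xS.
pose p u := val (cover u).
have pS u : p u \in S by have /andP[] := valP (cover u).
have p_branch u : branch S (p u) u by have /andP[] := valP (cover u).
have p_uniq x u : x \in S -> branch S x u -> p u = x.
  by move=> xS xu; apply: (branch_inj maxS cliqueS).
have p_id x : x \in S -> p x = x.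
  by move=> xS; apply: p_uniq; rewrite ?branch_refl.
(* The branch of [u] is left through [p u], which is adjacent to [x] because [S] is a clique. *)
have exit (u x : G) : x \in S -> x != p u -> dist u x = dist u (p u) + 1.
  move=> xS nx.
  rewrite (@dist_exit _ (branch S (p u)) (p u)) ?(branch_in _ xS) //.
    congr (_ + _); apply/eqP; rewrite eqn_leq dist_adj ?cliqueS 1?eq_sym //.
    by rewrite lt0n dist_eq0 // eq_sym.
  by move=> a b; apply: branch_exit.
have formula (u v : G) :
    p u != p v -> dist u v = dist u (p u) + dist v (p v) + 1.
  move=> npuv; rewrite (@dist_exit _ (branch S (p u)) (p u)) //.
  - by rewrite (sym (p u) v) (exit v (p u)) // addnA.
  - by move=> a b; apply: branch_exit.
  - by apply: contraNN npuv => /(p_uniq _ _ (pS u)) ->.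
(* If [l] hung from another root, [c] would be as far from [l] as a vertex of [S] can be. *)
have toward (l c c' : G) :
    c \in S -> c' \in S -> dist l c < dist l c' -> p l = c.
  move=> cS c'S; apply: contraTeq => npl.
  rewrite -leqNgt (exit l c) // 1?eq_sym //.
  have [->|nc'] := eqVneq c' (p l); first exact: leq_addr.
  by rewrite (exit l c').
have pl1 : p l1 = c1.
  apply: (toward _ _ c2) => //; have := tri l1 c2 l2.
  by rewrite dl diamE d1 d2; lia.
have pl2 : p l2 = c2.
  apply: (toward _ _ c1) => //; have := tri l1 c1 l2.
  by rewrite dl diamE d1 -d2 (sym l2 c2) (sym l2 c1); lia.
exists p, k, c1, c2, l1, l2; split=> //.
- by split=> //; exact: p_id.
- by rewrite (sym l2).
- move=> u; split.
    (* Compare with the path end below a pole other than [p u]: its distance, the depth plus k+1, is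
       at most 2k+1. *)
    have [puc1|npuc1] := eqVneq (p u) c1.
      have := dist_diam u l2; rewrite formula ?pl2 ?puc1 // (sym l2) d2; lia.
    by have := dist_diam u l1; rewrite formula ?pl1 // d1; lia.
  have [|npu] := eqVneq (p u) u; first by left.
  right; have [|npc1] := eqVneq (p u) c1; first by left.
  (* Otherwise [p u], [c1], [c2] are three cut-vertices of one block, with [u], [l1], [l2] hanging
     from them. *)
  right; apply/eqP; apply: contraTT isT => npc2.
  have c1cut : c1 \in cut_vertices [set: G] (@adj G).
    apply: (branch_cut maxS cliqueS c1S c2S nc (u := l1)).
      by rewrite -{1}pl1.
    by rewrite -dist_eq0 // d1 -lt0n.
  have c2cut : c2 \in cut_vertices [set: G] (@adj G).
    apply: (branch_cut maxS cliqueS c2S c1S _ (u := l2)); rewrite 1?eq_sym //.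
      by rewrite -{1}pl2.
    by rewrite -dist_eq0 // d2 -lt0n.
  have pcut : p u \in cut_vertices [set: G] (@adj G).
    apply: (branch_cut maxS cliqueS (pS u) c1S npc1 (u := u)) => //.
    by rewrite eq_sym.
  have sub : [set p u; c1; c2] \subset S :&: cut_vertices [set: G] (@adj G).
    apply/subsetP => w; rewrite !in_setU !in_set1 -orbA.
    by case/or3P=> /eqP->; rewrite in_setI ?pS ?c1S ?c2S.
  have := leq_trans (subset_leq_card sub) (cutB _ blockS).
  by rewrite -setUA cardsU1 cards2 !inE negb_or npc1 npc2 nc.
- move=> u v; split=> [puv|/formula //].
  by rewrite (leq_trans (tri u (p u) v)) // puv (sym (p v)).
Qed.

(** * Inertia of real symmetric matrices *)

Local Open Scope ring_scope.
Local Open Scope sesquilinear_scope.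

Lemma diag_hermitian_form (C : numClosedFieldType) n (d x : 'rV[C]_n) :
  (x *m diag_mx d *m x ^t*) 0 0 = \sum_i d 0 i * `|x 0 i| ^+ 2.
Proof.
rewrite mxE; apply: eq_bigr => i _.
by rewrite mul_mx_diag !mxE normCK mulrAC mulrC.
Qed.

Lemma exists_left_kernel (F : fieldType) m n (A : 'M[F]_(m, n)) :
  (n < m)%N -> exists2 x : 'rV_m, x != 0 & x *m A = 0.
Proof.
move=> ltnm; have : kermx A != 0.
  by rewrite kermx_eq0 -row_leq_rank -ltnNge (leq_ltn_trans (rank_leq_col A)).
by case/rowV0Pn => x /sub_kermxP xA0 nzx; exists x.
Qed.

(* If there were fewer positive entries than [m], some nonzero vector of the
   [m]-dimensional space would have all its positive coordinates equal to 0. *)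
Lemma leq_card_pos_diag (C : numClosedFieldType) m n (P : 'M[C]_n)
    (d : 'rV[C]_n) (Q : 'M[C]_(m, n)) :
    d \is a realmx ->
    (forall x : 'rV_m, x != 0 ->
      0 < (x *m Q *m (P ^t* *m diag_mx d *m P) *m (x *m Q) ^t*) 0 0) ->
  (m <= #|[set i | (0 < d 0 i)%R]|)%N.
Proof.
move=> d_real posQ; rewrite leqNgt; apply/negP => /= ltm.
set I := [set i | _] in ltm.
have [x nzx xB0] :=
  exists_left_kernel (colsub (fun k : 'I_#|I| => enum_val k) (Q *m P ^t*)) ltm.
have := posQ x nzx; set y := x *m Q *m P ^t*.
have -> : x *m Q *m (P ^t* *m diag_mx d *m P) *m (x *m Q) ^t*
    = y *m diag_mx d *m y ^t*.
  by rewrite /y [in RHS]trmx_mul map_mxM trmxCK !mulmxA.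
rewrite diag_hermitian_form => /lt_geF/negP[]; apply: sumr_le0 => i _.
have [iI|] := boolP (i \in I).
  have -> : y 0 i = 0; last by rewrite normr0 expr0n mulr0.
  have /rowP/(_ (enum_rank_in iI i)) := xB0.
  by rewrite mulmx_colsub mulmxA -/y [LHS]mxE [RHS]mxE enum_rankK_in.
rewrite inE -real_leNgt ?real0 ?(mxOverP d_real) // => di.
by rewrite mulr_le0_ge0 ?exprn_ge0.
Qed.

Lemma leq_card_neq0_rank_diag (F : fieldType) n (d : 'rV[F]_n) :
  (#|[set i | (d 0 i != 0)%R]| <= \rank (diag_mx d))%N.
Proof.
set I := [set i | _]; pose f (k : 'I_#|I|) := enum_val k.
have free_sub : row_free (rowsub f (diag_mx d)).
  (* The right inverse carries the reciprocals of the selected entries. *)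
  apply/row_freeP; exists (\matrix_(i, k) ((i == f k)%:R / d 0 i)).
  apply/matrixP => i j; rewrite mul_rowsub_mx mul_diag_mx !mxE.
  rewrite (inj_eq enum_val_inj); case: eqVneq => [->|_].
    2: by rewrite mul0r mulr0.
  by have := enum_valP j; rewrite inE mul1r => /mulfV.
by move/eqP: free_sub => <-; apply/mxrankS/rowsub_sub.
Qed.

Lemma char_poly_conj (F : comUnitRingType) n (P D : 'M[F]_n) :
  P \in unitmx -> char_poly (invmx P *m D *m P) = char_poly D.
Proof.
move=> Pu; pose c (M : 'M[F]_n) := map_mx polyC M.
have cV : c (invmx P) *m c P = 1%:M by rewrite -map_mxM mulVmx // map_mx1.
rewrite /char_poly; have -> : char_poly_mx (invmx P *m D *m P)
    = c (invmx P) *m char_poly_mx D *m c P.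
  rewrite /char_poly_mx mulmxBr mulmxBl /c !map_mxM; congr (_ - _).
  by rewrite [_ *m 'X%:M](scalar_mxC 'X (c (invmx P))) -mulmxA cV mulmx1.
by rewrite !det_mulmx mulrAC -det_mulmx cV det1 mul1r.
Qed.

(** Over [R[i]] the matrix is hermitian, so it is unitarily diagonalizable with real eigenvalues;
    rank and characteristic polynomial then descend to [R]. *)
Lemma symmetric_spectral (R : rcfType) n (E : 'M[R]_n) : E^T = E ->
  exists (d : 'rV[R]_n) (P : 'M[R[i]]_n),
    [/\ map_mx (real_complex R) E
          = P ^t* *m diag_mx (map_mx (real_complex R) d) *m P,
        \rank E = \rank (diag_mx d)
      & char_poly E = \prod_i ('X - (d 0 i)%:P)].
Proof.
move=> symE; set A := map_mx _ E.
have A_real : A \is a realmx.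
  by apply/mxOverP => i j; rewrite mxE; apply/complex_realP; exists (E i j).
have A_herm : A \is hermsymmx.
  apply: realsym_hermsym => //; apply/is_hermitianmxP.
  by rewrite expr0 scale1r map_mx_id // map_trmx symE.
have P_u := spectral_unit A; have P_unitary := spectral_unitarymx A.
have /mxOverP d_real := hermitian_spectral_diag_real A_herm.
have /orthomx_spectralP A_eq := hermitian_normalmx A_herm.
pose d : 'rV[R]_n := \row_i complex.Re (spectral_diag A 0 i).
have d_eq : spectral_diag A = map_mx (real_complex R) d.
  by apply/rowP => i; rewrite !mxE RRe_real.
exists d, (spectralmx A); split => //.
- by rewrite -d_eq -invmx_unitary.
- rewrite -(mxrank_map (real_complex R)) -/A A_eq d_eq.
  rewrite mxrankMfree ?row_free_unit // eqmxMfull ?row_full_unit ?unitmx_inv //.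
  by rewrite -map_diag_mx mxrank_map.
- apply: (map_poly_inj (real_complex R)).
  rewrite map_char_poly -/A A_eq char_poly_conj //.
  rewrite char_poly_trig ?diag_mx_is_trig //.
  rewrite rmorph_prod; apply: eq_bigr => i _.
  by rewrite mxE eqxx d_eq mxE rmorphB /= map_polyX map_polyC.
Qed.

(** The multiplicity of [x] in the product is the number of [i] with [d 0 i = x]; exchanging the
    sums counts each index once. *)
Lemma eigen_count_card (R : realType) n (E : 'M[R]_n) (d : 'rV[R]_n)
    (A : pred R) :
  char_poly E = \prod_i ('X - (d 0 i)%:P) ->
  eigen_count E A = #|[set i | A (d 0%R i)]|.
Proof.
move=> charE; rewrite /eigen_count; set r := rootsR _.
have r_uniq : uniq r by apply: sorted_uniq (sorted_roots _ _ _);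
  [exact: lt_trans | exact: ltxx].
have mem_r i : d 0 i \in r.
  rewrite -(roots_on_rootsR (monic_neq0 (char_poly_monic E))) in_itv /= charE.
  rewrite -(big_map (d 0) predT (fun x => 'X - x%:P)) root_prod_XsubC.
  by rewrite map_f ?mem_index_enum.
transitivity (\sum_(x <- r | A x) \sum_i (d 0%R i == x))%N.
  apply: eq_bigr => x _.
  rewrite charE -(big_map (d 0) predT (fun x => 'X - x%:P)) mu_prod_XsubC.
  rewrite -sum1_count big_map big_mkcond /=.
  by apply: eq_bigr => i _; case: (d 0 i == x).
rewrite exchange_big -sum1dep_card [RHS]big_mkcond; apply: eq_bigr => i _.
rewrite big_mkcond (bigD1_seq (d 0 i)) //= eqxx big1 ?addn0.
  by case: (A _).
by move=> x /negPf; rewrite eq_sym => ->; case: (A x).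
Qed.

(** A squeeze: the subspaces force at least [p] positive and [q] negative entries of [d], and the
    rank allows at most [p + q] nonzero ones. *)
Lemma inertia_of_definite_subspaces (R : realType) n p q (E : 'M[R]_n)
    (Qp : 'M[R[i]]_(p, n)) (Qn : 'M[R[i]]_(q, n))
    (A := map_mx (real_complex R) E) :
    E^T = E -> (\rank E <= p + q)%N ->
    (forall x : 'rV_p, x != 0 ->
       0 < (x *m Qp *m A *m (x *m Qp) ^t*) 0 0) ->
    (forall x : 'rV_q, x != 0 ->
       (x *m Qn *m A *m (x *m Qn) ^t*) 0 0 < 0) ->
  \rank E = (p + q)%N /\ inertia E = (p, q, n - (p + q))%N.
Proof.
move=> symE rankE posQ negQ.
have [d [P [A_eq rank_d charE]]] := symmetric_spectral symE.
have d_real : map_mx (real_complex R) d \is a realmx.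
  by apply/mxOverP => i j; rewrite mxE; apply/complex_realP; exists (d i j).
have leqp : (p <= #|[set i | (0 < d 0 i)%R]|)%N.
  have := @leq_card_pos_diag _ p n P _ Qp d_real.
  rewrite -A_eq -/A => /(_ posQ); congr (_ <= _)%N.
  by apply: eq_card => i; rewrite !inE mxE ltcR.
have leqq : (q <= #|[set i | (d 0 i < 0)%R]|)%N.
  have Nd_real : map_mx (real_complex R) (- d) \is a realmx.
    apply/mxOverP => i j; rewrite mxE; apply/complex_realP.
    by exists ((- d) i j).
  (* The negative entries of [d] are counted as positive entries of [- d]. *)
  have := @leq_card_pos_diag _ q n P _ Qn Nd_real.
  rewrite map_mxN raddfN /= mulmxN mulNmx -A_eq -/A => le_q.
  apply: leq_trans (le_q _) _ => [x nzx|].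
    by rewrite mulmxN mulNmx mxE oppr_gt0 negQ.
  apply: subset_leq_card; apply/subsetP => i.
  by rewrite !inE !mxE -rmorphN ltcR oppr_gt0.
have := leq_card_neq0_rank_diag d; rewrite -rank_d.
have cardD : #|[set i | (d 0 i != 0)%R]|
    = (#|[set i | (0 < d 0 i)%R]| + #|[set i | (d 0 i < 0)%R]|)%N.
  rewrite -cardsUI [X in (_ + #|pred_of_set X|)%N](_ : _ = set0) ?cards0 ?addn0.
    by apply: eq_card => i; rewrite !inE neq_lt orbC.
  by apply/setP => i; rewrite !inE; case: ltgtP.
have cardC : (#|[set i | (d 0 i == 0)%R]| + #|[set i | (d 0 i != 0)%R]|)%N = n.
  rewrite -[RHS]card_ord -(cardsC [set i | (d 0 i == 0)%R]).
  by congr (_ + _)%N; apply: eq_card => i; rewrite !inE.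
rewrite /inertia !(eigen_count_card _ charE) /= => le_rank.
move: cardD cardC leqp leqq le_rank rankE.
set nz := #|_|; set pos := #|_|; set neg := #|_|; set z := #|_|.
move: (\rank E) nz pos neg z.
by move=> {rank_d} *; split; [|congr (_, _, _)]; lia.
Qed.

(** * Two planes on which the form is definite *)

Definition mx_form (C : numClosedFieldType) n (A : 'M[C]_n)
    (u v : 'rV[C]_n) : C :=
  (u *m A *m v ^t*) 0 0.

Lemma mx_formDl (C : numClosedFieldType) n (A : 'M[C]_n) u1 u2 v :
  mx_form A (u1 + u2) v = mx_form A u1 v + mx_form A u2 v.
Proof. by rewrite /mx_form !mulmxDl mxE. Qed.

Lemma mx_formDr (C : numClosedFieldType) n (A : 'M[C]_n) u v1 v2 :
  mx_form A u (v1 + v2) = mx_form A u v1 + mx_form A u v2.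
Proof. by rewrite /mx_form linearD map_mxD mulmxDr mxE. Qed.

Lemma mx_formZl (C : numClosedFieldType) n (A : 'M[C]_n) a u v :
  mx_form A (a *: u) v = a * mx_form A u v.
Proof. by rewrite /mx_form -!scalemxAl mxE. Qed.

Lemma mx_formZr (C : numClosedFieldType) n (A : 'M[C]_n) a u v :
  mx_form A u (a *: v) = a^* * mx_form A u v.
Proof. by rewrite /mx_form linearZ /= map_mxZ -scalemxAr mxE. Qed.

Lemma mx_form_delta (C : numClosedFieldType) n (A : 'M[C]_n) i j :
  mx_form A (delta_mx 0 i) (delta_mx 0 j) = A i j.
Proof. by rewrite /mx_form trmx_delta map_delta_mx -rowE -colE !mxE. Qed.

(* [s] = 1 and [s] = -1 give a positive and a negative definite plane. *)
Lemma hyperbolic_mx_form (R : realType) n (A : 'M[R[i]]_n) (l1 l2 c1 c2 : 'I_n)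
    (k : nat) (s x0 x1 : R[i])
    (u := x0 *: (delta_mx 0 l1 + s *: delta_mx 0 c2)
        + x1 *: (delta_mx 0 l2 + s *: delta_mx 0 c1)) :
    A^T = A -> s = 1 \/ s = -1 ->
    [/\ A l1 l1 = 0, A l2 l2 = 0, A c1 c1 = 0, A c2 c2 = 0 & A c1 c2 = 0] ->
    [/\ A l1 c1 = 0, A l2 c2 = 0, A l1 c2 = k.+1%:R, A l2 c1 = k.+1%:R
      & A l1 l2 = k.*2.+1%:R] ->
  mx_form A u u
    = s * (k.*2.+1%:R * `|x0 + s * x1| ^+ 2 + (`|x0| ^+ 2 + `|x1| ^+ 2)).
Proof.
move=> symA hs [a1 a2 a3 a4 a5] [b1 b2 b3 b4 b5].
have sym i j : A i j = A j i by rewrite -{1}symA mxE.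
rewrite /u !(mx_formDl, mx_formDr, mx_formZl, mx_formZr) !mx_form_delta.
rewrite a1 a2 a3 a4 a5 b1 b2 b3 b4 b5.
rewrite (sym c2 l2) (sym c1 l1) (sym c2 l1) (sym c1 l2) (sym l2 l1) (sym c2 c1).
rewrite a5 b1 b2 b3 b4 b5 !normCK rmorphD rmorphM.
rewrite -!natr1 -muln2 natrM.
by case: hs => ->; rewrite ?rmorphN rmorph1; ring.
Qed.

Lemma hyperbolic_mx_form_gt0 (R : realType) (k : nat) (x0 x1 s : R[i]) :
  (x0 != 0) || (x1 != 0) ->
  0 < k.*2.+1%:R * `|x0 + s * x1| ^+ 2 + (`|x0| ^+ 2 + `|x1| ^+ 2).
Proof.
move=> nz; apply: ltr_wpDl; first by rewrite mulr_ge0 ?ler0n ?exprn_ge0.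
case/orP: nz => nz; [apply: ltr_pwDl | apply: ltr_wpDl];
  by rewrite ?exprn_ge0 ?exprn_gt0 ?normr_gt0.
Qed.

Lemma inertia_hyperbolic (R : realType) n (E : 'M[R]_n) (l1 l2 c1 c2 : 'I_n)
    (k : nat) :
    E^T = E -> (\rank E <= 4)%N ->
    [/\ E l1 l1 = 0, E l2 l2 = 0, E c1 c1 = 0, E c2 c2 = 0 & E c1 c2 = 0] ->
    [/\ E l1 c1 = 0, E l2 c2 = 0, E l1 c2 = k.+1%:R, E l2 c1 = k.+1%:R
      & E l1 l2 = k.*2.+1%:R] ->
  \rank E = 4 /\ inertia E = (2, 2, n - 4)%N.
Proof.
move=> symE rankE [a1 a2 a3 a4 a5] [b1 b2 b3 b4 b5].
set A := map_mx (real_complex R) E.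
(* Writing the dimension as [1 + 1] lets a coefficient vector split into its two coordinates. *)
pose Q (s : R[i]) : 'M_(1 + 1, n) :=
  col_mx (delta_mx 0 l1 + s *: delta_mx 0 c2)
         (delta_mx 0 l2 + s *: delta_mx 0 c1).
have form (s : R[i]) (x : 'rV[R[i]]_(1 + 1)) : s = 1 \/ s = -1 -> x != 0 ->
    exists2 t : R[i], 0 < t & (x *m Q s *m A *m (x *m Q s) ^t*) 0 0 = s * t.
  move=> hs nzx; rewrite -/(mx_form A _ _).
  have -> : x *m Q s = lsubmx x 0 0 *: (delta_mx 0 l1 + s *: delta_mx 0 c2)
      + rsubmx x 0 0 *: (delta_mx 0 l2 + s *: delta_mx 0 c1).
    by rewrite -{1}[x]hsubmxK mul_row_col -!mul_scalar_mx -!mx11_scalar.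
  rewrite (@hyperbolic_mx_form _ _ A l1 l2 c1 c2 k) //.
  - eexists; last by []. apply: hyperbolic_mx_form_gt0.
    apply: contraNT nzx; rewrite negb_or !negbK => /andP[/eqP x0 /eqP x1].
    rewrite -[x]hsubmxK [lsubmx x]mx11_scalar [rsubmx x]mx11_scalar x0 x1.
    by rewrite !raddf0 row_mx0.
  - by rewrite /A map_trmx symE.
  - by rewrite !mxE a1 a2 a3 a4 a5 !rmorph0.
  - by rewrite !mxE b1 b2 b3 b4 b5 !rmorph0 !rmorph_nat.
apply: (@inertia_of_definite_subspaces R n (1 + 1) (1 + 1) E (Q 1) (Q (-1)))
  => // x nzx.
- by have [t t_gt0 ->] := form 1 x (or_introl erefl) nzx; rewrite mul1r.
- have [t t_gt0 ->] := form (-1) x (or_intror erefl) nzx.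
  by rewrite mulN1r oppr_lt0.
Qed.

(* [u] hangs at depth [a u] below the vertex [p u] of a clique; [k] is the
   largest depth, attained only below [c1] and [c2]. *)
Lemma inertia_two_pole (R : realType) (V : finType) (p : V -> V) (a : V -> nat)
    (k : nat) (c1 c2 l1 l2 : V) (E : 'M[R]_#|V|) :
    (0 < k)%N -> c1 != c2 ->
    p c1 = c1 -> p c2 = c2 -> p l1 = c1 -> p l2 = c2 ->
    a c1 = 0%N -> a c2 = 0%N -> a l1 = k -> a l2 = k ->
    (forall u, a u = k -> p u = c1 \/ p u = c2) ->
    (forall i j, let u := enum_val i in let v := enum_val j in
      E i j = if (p u != p v) && ((a u == k) || (a v == k))
              then (a u + a v + 1)%:R else 0) ->
  \rank E = 4 /\ inertia E = (2, 2, #|V| - 4)%N.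
Proof.
move=> k_gt0 nc pc1 pc2 pl1 pl2 ac1 ac2 al1 al2 polar entE.
have k0 : (k == 0%N) = false by rewrite eqn0Ngt k_gt0.
have k0' : (0%N == k) = false by rewrite eq_sym k0.
have nc' : c2 != c1 by rewrite eq_sym.
have entR u v : E (enum_rank u) (enum_rank v) =
    if (p u != p v) && ((a u == k) || (a v == k))
    then (a u + a v + 1)%:R else 0.
  by rewrite entE !enum_rankK.
apply: (@inertia_hyperbolic _ _ _ (enum_rank l1) (enum_rank l2) (enum_rank c1)
  (enum_rank c2) k).
- by apply/matrixP => i j; rewrite mxE !entE eq_sym orbC [(a _ + _)%N]addnC.
- pose f c : 'cV[R]_#|V| :=
    \col_i ((p (enum_val i) == c) && (a (enum_val i) == k))%:R.
  pose g c' : 'cV[R]_#|V| :=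
    \col_i (if p (enum_val i) == c' then 0 else (k + 1 + a (enum_val i))%:R).
  (* The entry at two vertices of depth [k] below different poles would be
     counted twice, through [g c1] and through [g c2]: [g2] drops one copy. *)
  pose g2 : 'cV[R]_#|V| := g c1 - (k.*2.+1)%:R *: f c2.
  have -> : E = f c1 *m g2^T + g2 *m (f c1)^T
      + (f c2 *m (g c2)^T + g c2 *m (f c2)^T).
    apply/matrixP => i j; rewrite entE /=.
    have outer (v w : 'cV[R]_#|V|) : (v *m w^T) i j = v i 0 * w j 0.
      by rewrite mxE big_ord1 mxE.
    have add (M N : 'M[R]_#|V|) : (M + N) i j = M i j + N i j by rewrite mxE.
    rewrite !add !outer !mxE.
    move: (enum_val i) (enum_val j) => u v.
    have := polar u; have := polar v.
    (* At depth [k], [polar] places a vertex below a pole; if neither depth is [k], every product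
       vanishes. *)
    have [au|au] := eqVneq (a u) k; have [av|av] := eqVneq (a v) k;
      rewrite /= ?andbF ?andbT /=.
    + move=> /(_ av) pv /(_ au) pu.
      case: pu => ->; case: pv => ->;
        rewrite ?eqxx ?(negPf nc) ?(negPf nc') /= au av -muln2;
        by rewrite -?natr1 ?natrD ?natrM; ring.
    + move=> _ /(_ au) [] ->; rewrite eq_sym ?eqxx ?(negPf nc) ?(negPf nc') /=;
        case: eqP => _ /=; rewrite ?au ?natrD; ring.
    + move=> /(_ av) [] -> _; rewrite ?eqxx ?(negPf nc) ?(negPf nc') /=;
        case: eqP => _ /=; rewrite ?av ?natrD; ring.
    + by move=> _ _; ring.
  by rewrite (leq_trans (mxrank_add _ _)) // (@leq_add _ _ 2 2) //;
    rewrite (leq_trans (mxrank_add _ _)) // (@leq_add _ _ 1 1) //;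
    exact: mulmx_max_rank.
(* The entry between the poles is 0 because both have depth 0, which is not [k]. *)
- by rewrite !entR ?pc1 ?pc2 ?pl1 ?pl2 ?ac1 ?ac2 !eqxx /= k0' andbF.
- rewrite !entR ?pc1 ?pc2 ?pl1 ?pl2 ?ac1 ?ac2 ?al1 ?al2 !eqxx nc nc' /=.
  by rewrite -addnn !addn0 addn1 addn1.
Qed.

Local Close Scope sesquilinear_scope.
Local Close Scope ring_scope.

(** * Eccentricities and the entries of the matrix *)

Theorem theorem3p2 (R : realType) (G : sgraph) (n : nat) (hn : #|G| = n)
    (hG : CT_ge2_odd G) :
  \rank (ecc_mx R G) = 4 /\ inertia (ecc_mx R G) = (2, 2, n - 4).
Proof.
have [p [k [c1 [c2 [l1 [l2 [[k_gt0 nc] [pc1 pc2 pl1 pl2] [al1 al2] depth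
  dist_p]]]]]]] := CT_odd_structure hG.
have a_le u := (depth u).1.
(* The value is attained at [l2] from below [c1], and at [l1] from everywhere else. *)
have ecc_p u : ecc u = dist u (p u) + k + 1.
  apply/eqP; rewrite eqn_leq; apply/andP; split.
    apply/bigop.bigmax_leqP => v _; have [d_eq d_neq] := dist_p u v.
    have := a_le v; have [/d_eq|/d_neq] := eqVneq (p u) (p v); lia.
  have [puc1|npuc1] := eqVneq (p u) c1.
    have := (dist_p u l2).2; rewrite pl2 puc1 nc al2 addnAC => /(_ isT) <-.
    exact: bigop.leq_bigmax.
  have := (dist_p u l1).2; rewrite pl1 al1 npuc1 addnAC => /(_ isT) <-.
  exact: bigop.leq_bigmax.
rewrite -hn; apply: (inertia_two_pole (p := p) (a := fun u => dist u (p u))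
  (k := k) (c1 := c1) (c2 := c2) (l1 := l1) (l2 := l2));
  rewrite ?pc1 ?pc2 ?pl1 ?pl2 ?distxx //.
- move=> u auk; have [_ [pu|//]] := depth u.
  by move: auk; rewrite pu distxx => k0; rewrite -k0 in k_gt0.
- move=> i j u v; rewrite mxE -/u -/v /ecc_entry !ecc_p.
  have := a_le u; have := a_le v; have [d_eq d_neq] := dist_p u v.
  (* Within a branch the distance is at most the sum of the depths, hence below both
     eccentricities. *)
  have [/d_eq|/[dup] /d_neq d_uv npuv] := eqVneq (p u) (p v).
    by case: eqP => //; lia.
  (* Across branches it equals the smaller eccentricity exactly when the larger depth is [k]. *)
  rewrite d_uv => av_le au_le /=; congr (if _ then _ else _).
  by apply/eqP/orP => [?|[]/eqP]; lia.
Qed.
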